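(* Let $\mathcal{T} = (T, \eta, \mu)$ be a monad over a category $\mathbb{C}$. If $\mathbb{C}$ has (binary cartesian) products, then the Eilenberg–Moore category $\mathbb{C}^{\mathcal{T}}$ has (binary cartesian) products, where for $\mathcal{T}$-algebras $\bar{A} = (A, f_A)$ and $\bar{B} = (B, f_B)$ the product is given by $$\bar{A} \times \bar{B} = \bigl(A \times B,\ (f_A \times f_B) \circ \langle T\pi_1, T\pi_2 \rangle\bigr),$$ with projections $\bar{A} \times \bar{B} \to \bar{A}$ and $\bar{A} \times \bar{B} \to \bar{B}$ the projections $\pi_1 : A \times B \to A$ and $\pi_2 : A \times B \to B$ of $\mathbb{C}$.
   Context: A monad $\mathcal{T} = (T, \eta, \mu)$ over $\mathbb{C}$ consists of an endofunctor $T : \mathbb{C} \to \mathbb{C}$ and natural transformations $\eta : \mathrm{id}_{\mathbb{C}} \to T$ and $\mu : T^2 \to T$ with $\mu_A \circ T\mu_A = \mu_A \circ \mu_{TA}$ and $\mu_A \circ \eta_{TA} = \mathrm{id}_{TA} = \mu_A \circ T\eta_A$ for every object $A$. The Eilenberg–Moore category $\mathbb{C}^{\mathcal{T}}$ has as objects the $\mathcal{T}$-algebras, i.e. pairs $\bar{A} = (A, f_A)$ with $A$ an object of $\mathbb{C}$ and $f_A : TA \to A$ a morphism of $\mathbb{C}$ such that $f_A \circ \eta_A = \mathrm{id}_A$ and $f_A \circ \mu_A = f_A \circ T f_A$. A morphism $(A, f_A) \to (B, f_B)$ is a morphism $f : A \to B$ in $\mathbb{C}$ such that $f \circ f_A =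 f_B \circ Tf$. Identities and composition are those of $\mathbb{C}$. For $f : D \to A$ and $g : D \to B$, $\langle f, g\rangle : D \to A \times B$ is the pairing, so that $\langle T\pi_1, T\pi_2\rangle : T(A \times B) \to TA \times TB$; and $f_A \times f_B : TA \times TB \to A \times B$ is the product of the two morphisms. *)

(* Defs.v *)
From Stdlib Require Import ProofIrrelevance.

Set Implicit Arguments.
Unset Strict Implicit.
Unset Printing Implicit Defensive.

Declare Scope cat_scope.
Delimit Scope cat_scope with cat.
Open Scope cat_scope.

Record category := Category {
  obj :> Type;
  hom : obj -> obj -> Type;
  idm : forall A : obj, hom A A;
  comp : forall A B D : obj, hom B D -> hom A B -> hom A D;
  comp_id_l : forall (A B : obj) (f : hom A B), comp (idm B) f = f;
  comp_id_r : forall (A B : obj) (f : hom A B), comp f (idm A) = f;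
  comp_assoc : forall (A B D E : obj) (h : hom D E) (g : hom B D) (f : hom A B),
    comp h (comp g f) = comp (comp h g) f
}.
Arguments idm {c} A.
Arguments comp {c A B D} g f.

Notation "A ~> B" := (hom A B) (at level 70, no associativity) : cat_scope.
Notation "g \o f" := (comp g f) (at level 50, left associativity) : cat_scope.

Record functor (C D : category) := Functor {
  fobj :> C -> D;
  fmap : forall A B : C, (A ~> B) -> (fobj A ~> fobj B);
  fmap_id : forall A : C, fmap (idm A) = idm (fobj A);
  fmap_comp : forall (A B E : C) (g : B ~> E) (f : A ~> B),
    fmap (g \o f) = fmap g \o fmap f
}.
Arguments fmap {C D} F {A B} f : rename.

Definition id_functor (C : category) : functor C C :=
  {| fobj := fun A : C => A;
     fmap := fun _ _ f => f;
     fmap_id := fun _ => eq_refl;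
     fmap_comp := fun _ _ _ _ _ => eq_refl |}.

Section FunctorComposition.
Variables (C D E : category) (G : functor D E) (F : functor C D).

Lemma comp_functor_id (A : C) : fmap G (fmap F (idm A)) = idm (G (F A)).
Proof. now rewrite fmap_id, fmap_id. Qed.

Lemma comp_functor_comp (A B A' : C) (g : B ~> A') (f : A ~> B) :
  fmap G (fmap F (g \o f)) = fmap G (fmap F g) \o fmap G (fmap F f).
Proof. now rewrite fmap_comp, fmap_comp. Qed.

Definition comp_functor : functor C E :=
  {| fobj := fun A => G (F A);
     fmap := fun _ _ f => fmap G (fmap F f);
     fmap_id := comp_functor_id;
     fmap_comp := comp_functor_comp |}.
End FunctorComposition.

Record nat_trans (C D : category) (F G : functor C D) := NatTrans {
  component :> forall A : C, F A ~> G A;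
  naturality : forall (A B : C) (f : A ~> B),
    component B \o fmap F f = fmap G f \o component A
}.

Record monad (C : category) := Monad {
  endo :> functor C C;
  eta : nat_trans (id_functor C) endo;
  mu : nat_trans (comp_functor endo endo) endo;
  mu_mu : forall A : C, mu A \o fmap endo (mu A) = mu A \o mu (endo A);
  mu_eta_T : forall A : C, mu A \o eta (endo A) = idm (endo A);
  mu_T_eta : forall A : C, mu A \o fmap endo (eta A) = idm (endo A)
}.
Arguments eta {C} m.
Arguments mu {C} m.

Record span (C : category) (A B : C) := Span {
  apex : C;
  leg1 : apex ~> A;
  leg2 : apex ~> B
}.
Arguments Span {C A B} apex leg1 leg2.

(* A choice of binary products: the notations A x B and <f, g> of the
   literature presuppose one. *)
Record binary_products (C : category) := BinaryProducts {
  prod_obj : C -> C -> C;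
  pi1 : forall {A B : C}, prod_obj A B ~> A;
  pi2 : forall {A B : C}, prod_obj A B ~> B;
  pairing : forall {A B D : C}, (D ~> A) -> (D ~> B) -> (D ~> prod_obj A B);
  pi1_pairing : forall (A B D : C) (f : D ~> A) (g : D ~> B),
    pi1 \o pairing f g = f;
  pi2_pairing : forall (A B D : C) (f : D ~> A) (g : D ~> B),
    pi2 \o pairing f g = g;
  pairing_unique : forall (A B D : C) (f : D ~> A) (g : D ~> B)
      (h : D ~> prod_obj A B),
    pi1 \o h = f -> pi2 \o h = g -> h = pairing f g
}.
Arguments prod_obj {C} P A B : rename.
Arguments pi1 {C} P {A B} : rename.
Arguments pi2 {C} P {A B} : rename.
Arguments pairing {C} P {A B D} f g : rename.

Definition prod_span (C : category) (P : binary_products C) (A B : C) :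
    span A B :=
  Span (prod_obj P A B) (pi1 P) (pi2 P).

Definition prod_hom (C : category) (P : binary_products C) (A B A' B' : C)
    (f : A ~> A') (g : B ~> B') : prod_obj P A B ~> prod_obj P A' B' :=
  pairing P (f \o pi1 P) (g \o pi2 P).
Arguments prod_hom {C} P {A B A' B'} f g.

Section EilenbergMoore.
Variables (C : category) (T : monad C).

Definition is_algebra (A : C) (a : T A ~> A) : Prop :=
  a \o eta T A = idm A /\ a \o mu T A = a \o fmap T a.

Record algebra := Algebra {
  carrier : C;
  structure : T carrier ~> carrier;
  algebraP : is_algebra structure
}.

Definition is_algebra_hom (A B : algebra) (f : carrier A ~> carrier B) : Prop :=
  f \o structure A = structure B \o fmap T f.

Record algebra_hom (A B : algebra) := AlgebraHom {
  underlying : carrier A ~> carrier B;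
  algebra_homP : is_algebra_hom underlying
}.

Lemma algebra_hom_eq (A B : algebra) (f g : algebra_hom A B) :
  underlying f = underlying g -> f = g.
Proof.
destruct f as [f Hf], g as [g Hg]; cbn; intros <-.
f_equal; apply proof_irrelevance.
Qed.

Lemma is_algebra_hom_id (A : algebra) : is_algebra_hom (idm (carrier A)).
Proof.
unfold is_algebra_hom; now rewrite fmap_id, comp_id_l, comp_id_r.
Qed.

Lemma is_algebra_hom_comp (A B D : algebra)
    (g : algebra_hom B D) (f : algebra_hom A B) :
  is_algebra_hom (underlying g \o underlying f).
Proof.
unfold is_algebra_hom.
rewrite fmap_comp, comp_assoc, <- (algebra_homP g), <- !comp_assoc.
now rewrite (algebra_homP f).
Qed.

Definition em_id (A : algebra) : algebra_hom A A :=
  AlgebraHom (is_algebra_hom_id A).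

Definition em_comp (A B D : algebra)
    (g : algebra_hom B D) (f : algebra_hom A B) : algebra_hom A D :=
  AlgebraHom (is_algebra_hom_comp g f).

Lemma em_comp_id_l (A B : algebra) (f : algebra_hom A B) :
  em_comp (em_id B) f = f.
Proof. apply algebra_hom_eq, comp_id_l. Qed.

Lemma em_comp_id_r (A B : algebra) (f : algebra_hom A B) :
  em_comp f (em_id A) = f.
Proof. apply algebra_hom_eq, comp_id_r. Qed.

Lemma em_comp_assoc (A B D E : algebra) (h : algebra_hom D E)
    (g : algebra_hom B D) (f : algebra_hom A B) :
  em_comp h (em_comp g f) = em_comp (em_comp h g) f.
Proof. apply algebra_hom_eq, comp_assoc. Qed.

Definition eilenberg_moore : category :=
  {| obj := algebra;
     hom := algebra_hom;
     idm := em_id;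
     comp := em_comp;
     comp_id_l := em_comp_id_l;
     comp_id_r := em_comp_id_r;
     comp_assoc := em_comp_assoc |}.
End EilenbergMoore.
Arguments Algebra {C T carrier structure} algebraP.
Arguments AlgebraHom {C T A B underlying} algebra_homP.

(* Main.v *)
Require Import Defs.

Set Implicit Arguments.
Unset Strict Implicit.
Unset Printing Implicit Defensive.

(** A morphism into a product is determined by its two composites with the
    projections ([prod_hom_ext]), and the proposed structure map on the product
    is the one morphism [c] with [pi1 \o c = structure A \o fmap T pi1] and
    [pi2 \o c = structure B \o fmap T pi2] ([pi1_prod_structure],
    [pi2_prod_structure]).  These two equations say precisely that the
    projections of the base category are algebra morphisms.

    Everything else is an equation between morphisms into a product, so it may
    be checked after composing with each projection, where it reduces to an
    equation in a factor: the algebra laws of the product follow from those of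
    the factors by naturality of [eta] and [mu] ([algebra_unit_transfer],
    [algebra_mult_transfer]), and the pairing of two algebra morphisms is an
    algebra morphism because both of its components are
    ([pairing_is_algebra_hom]).  The universal property is then inherited,
    since algebra morphisms are equal as soon as their underlying morphisms
    are. *)

Lemma prod_hom_ext (C : category) (P : binary_products C) (A B D : C)
    (h k : D ~> prod_obj P A B) :
  pi1 P \o h = pi1 P \o k -> pi2 P \o h = pi2 P \o k -> h = k.
Proof.
intros E1 E2.
rewrite (pairing_unique E1 E2).
symmetry; now apply pairing_unique.
Qed.

Section AlgebraLaws.
Variables (C : category) (T : monad C).

(** The source of [p] is not yet known to be an algebra: this and the next
    lemma extract, from the mere commutation of [p] with the structure maps,
    the image under [p] of an algebra law for [c]. *)
Lemma algebra_unit_transfer (X : C) (c : T X ~> X) (A : algebra T)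
    (p : X ~> carrier A) :
  p \o c = structure A \o fmap T p -> p \o (c \o eta T X) = p \o idm X.
Proof.
intros Hp.
rewrite comp_assoc, Hp, <- comp_assoc, comp_id_r.
rewrite <- (naturality (eta T) p), comp_assoc.
destruct (algebraP A) as [-> _].
apply comp_id_l.
Qed.

Lemma algebra_mult_transfer (X : C) (c : T X ~> X) (A : algebra T)
    (p : X ~> carrier A) :
  p \o c = structure A \o fmap T p ->
  p \o (c \o mu T X) = p \o (c \o fmap T c).
Proof.
intros Hp.
rewrite !comp_assoc, Hp, <- !comp_assoc, <- fmap_comp, Hp, fmap_comp.
rewrite <- (naturality (mu T) p), !comp_assoc.
now destruct (algebraP A) as [_ ->].
Qed.

End AlgebraLaws.

Section ProductAlgebra.
Variables (C : category) (T : monad C) (P : binary_products C).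

Definition prod_structure (A B : algebra T) :
    T (prod_obj P (carrier A) (carrier B)) ~> prod_obj P (carrier A) (carrier B) :=
  prod_hom P (structure A) (structure B)
    \o pairing P (fmap T (pi1 P)) (fmap T (pi2 P)).

Lemma pi1_prod_structure (A B : algebra T) :
  pi1 P \o prod_structure A B = structure A \o fmap T (pi1 P).
Proof.
unfold prod_structure, prod_hom.
now rewrite comp_assoc, pi1_pairing, <- comp_assoc, pi1_pairing.
Qed.

Lemma pi2_prod_structure (A B : algebra T) :
  pi2 P \o prod_structure A B = structure B \o fmap T (pi2 P).
Proof.
unfold prod_structure, prod_hom.
now rewrite comp_assoc, pi2_pairing, <- comp_assoc, pi2_pairing.
Qed.

Lemma prod_is_algebra (A B : algebra T) : is_algebra (prod_structure A B).
Proof.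
split; apply prod_hom_ext.
- apply algebra_unit_transfer, pi1_prod_structure.
- apply algebra_unit_transfer, pi2_prod_structure.
- apply algebra_mult_transfer, pi1_prod_structure.
- apply algebra_mult_transfer, pi2_prod_structure.
Qed.

Definition prod_algebra (A B : algebra T) : algebra T :=
  Algebra (prod_is_algebra A B).

Definition em_pi1 (A B : algebra T) : algebra_hom (prod_algebra A B) A :=
  @AlgebraHom C T (prod_algebra A B) A (pi1 P) (pi1_prod_structure A B).

Definition em_pi2 (A B : algebra T) : algebra_hom (prod_algebra A B) B :=
  @AlgebraHom C T (prod_algebra A B) B (pi2 P) (pi2_prod_structure A B).

Lemma pairing_is_algebra_hom (A B D : algebra T)
    (f : algebra_hom D A) (g : algebra_hom D B) :
  @is_algebra_hom C T D (prod_algebra A B)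
    (pairing P (underlying f) (underlying g)).
Proof.
unfold is_algebra_hom; cbn.
apply prod_hom_ext; rewrite !comp_assoc.
- rewrite pi1_pairing, pi1_prod_structure, <- comp_assoc, <- fmap_comp.
  rewrite pi1_pairing; apply algebra_homP.
- rewrite pi2_pairing, pi2_prod_structure, <- comp_assoc, <- fmap_comp.
  rewrite pi2_pairing; apply algebra_homP.
Qed.

Definition em_pairing (A B D : algebra T)
    (f : algebra_hom D A) (g : algebra_hom D B) :
    algebra_hom D (prod_algebra A B) :=
  AlgebraHom (pairing_is_algebra_hom f g).

Lemma em_pi1_pairing (A B D : algebra T)
    (f : algebra_hom D A) (g : algebra_hom D B) :
  em_comp (em_pi1 A B) (em_pairing f g) = f.
Proof. apply algebra_hom_eq, pi1_pairing. Qed.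

Lemma em_pi2_pairing (A B D : algebra T)
    (f : algebra_hom D A) (g : algebra_hom D B) :
  em_comp (em_pi2 A B) (em_pairing f g) = g.
Proof. apply algebra_hom_eq, pi2_pairing. Qed.

Lemma em_pairing_unique (A B D : algebra T)
    (f : algebra_hom D A) (g : algebra_hom D B)
    (h : algebra_hom D (prod_algebra A B)) :
  em_comp (em_pi1 A B) h = f -> em_comp (em_pi2 A B) h = g ->
  h = em_pairing f g.
Proof.
intros <- <-.
now apply algebra_hom_eq, pairing_unique.
Qed.

Definition em_products : binary_products (eilenberg_moore T) :=
  @BinaryProducts (eilenberg_moore T) prod_algebra em_pi1 em_pi2 em_pairing
    em_pi1_pairing em_pi2_pairing em_pairing_unique.

End ProductAlgebra.

Theorem theorem2 (C : category) (T : monad C) (P : binary_products C) :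
  exists Q : binary_products (eilenberg_moore T),
  forall A B : algebra T,
  exists (alg : @is_algebra C T (prod_obj P (carrier A) (carrier B))
            (prod_hom P (structure A) (structure B)
               \o pairing P (fmap T (pi1 P)) (fmap T (pi2 P))))
         (hom1 : @is_algebra_hom C T (Algebra alg) A (pi1 P))
         (hom2 : @is_algebra_hom C T (Algebra alg) B (pi2 P)),
    @prod_span (eilenberg_moore T) Q A B =
    @Span (eilenberg_moore T) A B (Algebra alg) (AlgebraHom hom1) (AlgebraHom hom2).
Proof.
exists (em_products T P); intros A B.
exists (prod_is_algebra P A B), (pi1_prod_structure P A B),
  (pi2_prod_structure P A B).
reflexivity.
Qed.
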